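(* Let $g(\mathbf W):=\frac12\|\mathbf W_1\mathbf W_2\cdots\mathbf W_N\mathbf X-\mathbf Y\|_F^2$, $f:=0$, and let $h$ be the kernel specified in the context. Consider the BPG iteration $\mathbf W^{\mathbf{k+1}}\in T_\lambda(\mathbf W^{\mathbf k})$. Denote $\mathbf P_i^k:=\lambda\nabla_{\mathbf W_i}g(\mathbf W^{\mathbf k})-\nabla_{\mathbf W_i}h(\mathbf W^{\mathbf k})$ and $\|\mathbf P\|_F^2:=\sum_{i=1}^N\|\mathbf P_i^k\|_F^2$. Then the update steps in each iteration are given by $$\mathbf W_i^{k+1}=-r\,\frac{\sqrt N\,\mathbf P_i^k}{\|\mathbf P\|_F}\qquad\text{for all } i\in\{1,\dots,N\},$$ where: (a) for $N=2$, $r\ge0$ satisfies $$2c_1(2)r^3+c_2(2)r-\frac{\|\mathbf P\|_F}{\sqrt2}=0;$$ (b) if $N>2$ and $N$ is even, $r\ge0$ satisfies $$2c_1(N)r^{2N-1}+c_2(N)r^{N-1}+\frac{2\rho}{N}r-\frac{\|\mathbf P\|_F}{\sqrt N}=0;$$ (c) if $N>2$ and $N$ is odd, $r\ge0$ satisfies $$2c_1(N)r^{2N-1}+c_3(N)\left(\frac{Nr^2+1}{N+1}\right)^{\frac{N-1}2}r+\frac{2\rho}{N}r-\frac{\|\mathbf P\|_F}{\sqrt N}=0.$$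
   Context: Setting: $N\ge2$ is an integer, $d_1,\dots,d_N,d,n_T$ are positive integers, $d_{N+1}:=d$, $\mathcal W_i:=\mathbb R^{d_i\times d_{i+1}}$, $\mathcal W:=\mathcal W_1\times\cdots\times\mathcal W_N$, with elements $\mathbf W=(\mathbf W_1,\dots,\mathbf W_N)$ and $\|\mathbf W\|_F^2:=\sum_{i=1}^N\|\mathbf W_i\|_F^2$. The matrices $\mathbf X\in\mathbb R^{d\times n_T}$, $\mathbf Y\in\mathbb R^{d_1\times n_T}$ are fixed. Constants and kernels: $c_1(N)=\frac{(2N-1)N^N}{2N!}\|\mathbf X\|_F^2$; for even $N$, $c_2(N)=\frac{\|\mathbf Y\|_F\|\mathbf X\|_F(N-1)N^{(N-2)/2}}{(N-2)^{(N-2)/2}}$ (with $0^0=1$ for $N=2$); for odd $N$, $c_3(N)=\frac{\|\mathbf Y\|_F\|\mathbf X\|_F(N-1)(N+1)^{(N-1)/2}}{(N-1)^{(N-1)/2}}$. $H_1(\mathbf W)=\left(\frac{\|\mathbf W\|_F^2}{N}\right)^N$, $H_2(\mathbf W)=\left(\frac{\|\mathbf W\|_F^2}{N}\right)^{N/2}$, $H_3(\mathbf W)=\left(\frac{\|\mathbf W\|_F^2+1}{N+1}\right)^{(N+1)/2}$, $H_4(\mathbf W)=\frac{\|\mathbf W\|_F^2}{N}$. The kernel $h$ is: for $N=2$, $h=c_1(2)H_1+c_2(2)H_2$; for even $N>2$, $h=c_1(N)H_1+c_2(N)H_2+\rho H_4$ with a fixed $\rho>0$; for odd $N>2$, $h=c_1(N)H_1+c_3(N)H_3+\rho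 H_4$ with a fixed $\rho\ge0$. It is a standing assumption that $h$ is $\sigma$-strongly convex for some $\sigma>0$. Bregman distance: $D_h(u,x)=h(u)-h(x)-\langle\nabla h(x),u-x\rangle$. BPG (Bregman Proximal Gradient) for minimizing $f+g$: fix a step size $0<\lambda<1/L$, where $L>0$ is such that $Lh-g$ and $Lh+g$ are convex on $\mathcal W$; choose an initial point, and for each $k\ge1$ compute $\mathbf W^{\mathbf{k+1}}\in T_\lambda(\mathbf W^{\mathbf k})$, where $$T_\lambda(x):=\operatorname*{argmin}_{u}\left\{f(u)+\langle\nabla g(x),u\rangle+\tfrac1\lambda D_h(u,x)\right\}.$$ Convention: if $\|\mathbf P\|_F=0$, the update formula is read as $\mathbf W_i^{k+1}=0$ for all $i$. *)

(* Defs.v *)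
From HB Require Import structures.
From mathcomp Require Export all_boot all_order all_algebra.
From mathcomp Require Export all_classical all_reals all_analysis.

Set Implicit Arguments.
Unset Strict Implicit.
Unset Printing Implicit Defensive.

Export Order.TTheory GRing.Theory Num.Theory.
Export numFieldNormedType.Exports.

Local Open Scope classical_set_scope.
Local Open Scope ring_scope.

(* Layers are numbered from 0: block i : 'I_N is the matrix W_(i+1), and the   *)
(* dimensions d_1, ..., d_N, d_(N+1) are dims 0, ..., dims N; the values of    *)
(* dims beyond N are irrelevant.                                               *)
Definition weights (R : realType) (N : nat) (dims : nat -> nat) : Type :=
  forall i : 'I_N, 'M[R]_(dims i, dims i.+1).

Section WeightsLmodule.
Variables (R : realType) (N : nat) (dims : nat -> nat).
Local Notation W := (weights R N dims).

HB.instance Definition _ :=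
  Choice.copy W (forall i : 'I_N, 'M[R]_(dims i, dims i.+1)).

Let zero : W := fun i => 0.
Let add (U V : W) : W := fun i => U i + V i.
Let opp (U : W) : W := fun i => - U i.
Let scale (a : R) (U : W) : W := fun i => a *: U i.

Let addA : associative add.
Proof. by move=> U V T; apply: functional_extensionality_dep => i; exact: addrA. Qed.
Let addC : commutative add.
Proof. by move=> U V; apply: functional_extensionality_dep => i; exact: addrC. Qed.
Let add0 : left_id zero add.
Proof. by move=> U; apply: functional_extensionality_dep => i; exact: add0r. Qed.
Let addN : left_inverse zero opp add.
Proof. by move=> U; apply: functional_extensionality_dep => i; exact: addNr. Qed.

HB.instance Definition _ := GRing.isZmodule.Build W addA addC add0 addN.

Let scaleA (a b : R) (U : W) : scale a (scale b U) = scale (a * b) U.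
Proof. by apply: functional_extensionality_dep => i; exact: scalerA. Qed.
Let scale1 : left_id 1 scale.
Proof. by move=> U; apply: functional_extensionality_dep => i; exact: scale1r. Qed.
Let scaleDr : right_distributive scale +%R.
Proof. by move=> a U V; apply: functional_extensionality_dep => i; exact: scalerDr. Qed.
Let scaleDl (U : W) : {morph scale^~ U : a b / a + b}.
Proof. by move=> a b; apply: functional_extensionality_dep => i; exact: scalerDl. Qed.

HB.instance Definition _ :=
  GRing.Zmodule_isLmodule.Build R W scaleA scale1 scaleDr scaleDl.

End WeightsLmodule.

Definition frob (R : realType) (m n : nat) (A : 'M[R]_(m, n)) : R :=
  Num.sqrt (\sum_(a < m) \sum_(b < n) A a b ^+ 2).

(* W_1 *m W_2 *m ... *m W_N (the identity when N = 0) *)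
Fixpoint wprod (R : realType) (dims : nat -> nat) (N : nat) :
    weights R N dims -> 'M[R]_(dims 0, dims N) :=
  match N with
  | 0 => fun=> 1%:M
  | n.+1 => fun U =>
      @wprod R dims n (fun i => U (widen_ord (leqnSn n) i)) *m U ord_max
  end.

Section Weights.
Variables (R : realType) (N : nat) (dims : nat -> nat).
Local Notation W := (weights R N dims).
Implicit Types (U V x u : W) (f g h F : W -> R).

Definition wnorm U : R := Num.sqrt (\sum_(i < N) frob (U i) ^+ 2).

Definition winner U V : R := \sum_(i < N) \tr ((U i)^T *m V i).

(* partial gradients: block i of wgrad F U is the matrix of the derivatives of *)
(* F with respect to the entries of block i, the other blocks being fixed      *)
Definition wgrad F U : W := fun i =>
  \matrix_(a, b) 'D_(delta_mx a b)
    (fun A : 'M[R]_(dims i, dims i.+1) => F (dfwith U i A)) (U i).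

Definition wconvex F : Prop :=
  convex_function [set: convex_lmodType W] F.

Definition strongly_convex (sigma : R) F : Prop :=
  wconvex (fun U => F U - sigma / 2 * wnorm U ^+ 2).

Definition bregman h u x : R := h u - h x - winner (wgrad h x) (u - x).

Definition bpg_map f g h (lambda : R) x : set W :=
  let obj u := f u + winner (wgrad g x) u + lambda^-1 * bregman h u x in
  [set u | forall v, obj u <= obj v].

Definition loss nT (X : 'M[R]_(dims N, nT)) (Y : 'M[R]_(dims 0, nT)) U : R :=
  2^-1 * frob (wprod U *m X - Y) ^+ 2.

(* H2 is only used for even N and H3 for odd N, where the halved exponents     *)
(* are exact.                                                                  *)
Definition H1 U : R := (wnorm U ^+ 2 / N%:R) ^+ N.
Definition H2 U : R := (wnorm U ^+ 2 / N%:R) ^+ N./2.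
Definition H3 U : R := ((wnorm U ^+ 2 + 1) / (N%:R + 1)) ^+ N.+1./2.
Definition H4 U : R := wnorm U ^+ 2 / N%:R.

End Weights.

Section Constants.
Variables (R : realType) (d d1 nT : nat).
Variables (X : 'M[R]_(d, nT)) (Y : 'M[R]_(d1, nT)).

Definition c1 (N : nat) : R :=
  (2 * N%:R - 1) * N%:R ^+ N / (2 * (N`!)%:R) * frob X ^+ 2.

(* for even N; at N = 2 the denominator is 0 ^+ 0 = 1 *)
Definition c2 (N : nat) : R :=
  frob Y * frob X * (N%:R - 1) * N%:R ^+ (N - 2)./2 / (N%:R - 2) ^+ (N - 2)./2.

(* for odd N *)
Definition c3 (N : nat) : R :=
  frob Y * frob X * (N%:R - 1) * (N%:R + 1) ^+ (N - 1)./2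
    / (N%:R - 1) ^+ (N - 1)./2.

End Constants.

Definition kernel (R : realType) (N nT : nat) (dims : nat -> nat)
    (X : 'M[R]_(dims N, nT)) (Y : 'M[R]_(dims 0, nT)) (rho : R)
    (U : weights R N dims) : R :=
  if N == 2 then c1 X 2 * H1 U + c2 X Y 2 * H2 U
  else if odd N then c1 X N * H1 U + c3 X Y N * H3 U + rho * H4 U
  else c1 X N * H1 U + c2 X Y N * H2 U + rho * H4 U.

(* When P = 0 the update is read as 0. *)
Definition bpg_update (R : realType) (N : nat) (dims : nat -> nat)
    (P : weights R N dims) (r : R) : weights R N dims := fun i =>
  if wnorm P == 0 then 0
  else - (r * (Num.sqrt N%:R / wnorm P)) *: P i.

(* Main.v *)
From mathcomp Require Import ring lra.
Require Import Defs.

Set Implicit Arguments.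
Unset Strict Implicit.
Unset Printing Implicit Defensive.

Local Open Scope classical_set_scope.
Local Open Scope ring_scope.

(** With f = 0, dropping the terms that do not depend on u from the objective of
    the proximal step leaves lambda^-1 (h u + <P, u>): the iterate is a minimizer
    of the kernel h tilted by the linear form of P ([bpg_map_minimizer]).

    The kernel is radial: h U = G (|U| / sqrt N), where G is a sum of powers with
    nonnegative coefficients, hence convex on the half line, and N e is its
    derivative.  By the Cauchy-Schwarz inequality,
      h V + <P, V> >= G t - sqrt N |P| t   with t = |V| / sqrt N,
    with equality when V is a nonpositive multiple of P.  The right-hand side is
    a convex function of t, and the scalar equation e r = |P| / sqrt N says that
    it is stationary at r; so any nonnegative root r makes the vector of length
    r sqrt N in the direction of -P a minimizer ([update_minimizes]).

    Strong convexity of h does the rest.  It makes the minimizer unique, so that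
    the iterate is this vector ([linear_tilt_minimizer_unique]); and it forces e
    to grow at least linearly ([slope_growth]), so that the scalar equation has a
    root by the intermediate value theorem ([slope_equation_solvable]).  This last
    point cannot be read off the coefficients alone, which may vanish (when
    X = 0, for instance).

    The tangent inequalities of the profiles all come from that of a power,
    [exprn_tangent], that is, from Bernoulli's inequality. *)

(** * The Euclidean structure on the weights *)

Section WeightsInnerProduct.
Variables (R : realType) (N : nat) (dims : nat -> nat).
Local Notation W := (weights R N dims).
Implicit Types (U V P : W).

Lemma winnerC U V : winner U V = winner V U.
Proof.
by apply: eq_bigr => i _; rewrite -mxtrace_tr trmx_mul trmxK.
Qed.

Lemma winnerDr P U V : winner P (U + V) = winner P U + winner P V.
Proof.
rewrite /winner -big_split /=; apply: eq_bigr => i _.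
by rewrite -mxtraceD -mulmxDr.
Qed.

Lemma winnerZr P a U : winner P (a *: U) = a * winner P U.
Proof.
rewrite /winner big_distrr /=; apply: eq_bigr => i _.
by rewrite -mxtraceZ scalemxAr.
Qed.

Lemma winnerNr P U : winner P (- U) = - winner P U.
Proof. by rewrite -scaleN1r winnerZr mulN1r. Qed.

Lemma winnerDl P U V : winner (U + V) P = winner U P + winner V P.
Proof. by rewrite !(winnerC _ P) winnerDr. Qed.

Lemma winnerZl P a U : winner (a *: U) P = a * winner U P.
Proof. by rewrite !(winnerC _ P) winnerZr. Qed.

Lemma winnerNl P U : winner (- U) P = - winner U P.
Proof. by rewrite !(winnerC _ P) winnerNr. Qed.

Lemma winner_self U :
  winner U U = \sum_i \sum_a \sum_b U i a b ^+ 2.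
Proof.
apply: eq_bigr => i _; rewrite /mxtrace exchange_big /=.
apply: eq_bigr => b _; rewrite mxE; apply: eq_bigr => a _.
by rewrite mxE expr2.
Qed.

Lemma wnorm_sqr U : wnorm U ^+ 2 = winner U U.
Proof.
have ge0 i : 0 <= \sum_a \sum_b U i a b ^+ 2.
  by apply: sumr_ge0 => a _; apply: sumr_ge0 => b _; exact: sqr_ge0.
rewrite winner_self /wnorm sqr_sqrtr; last first.
  by apply: sumr_ge0 => i _; exact: sqr_ge0.
by apply: eq_bigr => i _; rewrite sqr_sqrtr.
Qed.

Lemma wnorm_ge0 U : 0 <= wnorm U.
Proof. exact: sqrtr_ge0. Qed.

Lemma wnorm0_eq0 U : wnorm U = 0 -> U = 0.
Proof.
move=> U0; have /eqP := wnorm_sqr U; rewrite U0 expr0n /= eq_sym winner_self.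
have ge0 i a : 0 <= \sum_b U i a b ^+ 2.
  by apply: sumr_ge0 => b _; exact: sqr_ge0.
rewrite psumr_eq0 => [/allP Ui0|i _]; last by apply: sumr_ge0 => a _.
apply: functional_extensionality_dep => i; apply/matrixP => a b.
have := Ui0 i (mem_index_enum i); rewrite psumr_eq0 // => /allP Uia0.
have := Uia0 a (mem_index_enum a).
rewrite psumr_eq0 => [/allP Uiab0|? _]; last exact: sqr_ge0.
by have := Uiab0 b (mem_index_enum b); rewrite sqrf_eq0 mxE => /eqP.
Qed.

Lemma wnormZ a U : wnorm (a *: U) = `|a| * wnorm U.
Proof.
apply: (@pexpIrn _ 2) => //; rewrite ?nnegrE ?mulr_ge0 ?wnorm_ge0 //.
by rewrite exprMn !wnorm_sqr winnerZl winnerZr mulrA real_normK ?num_real.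
Qed.

Lemma wnormN U : wnorm (- U) = wnorm U.
Proof. by rewrite -scaleN1r wnormZ normrN1 mul1r. Qed.

(** The lower half of the Cauchy-Schwarz inequality. *)
Lemma winner_ge P U : - (wnorm P * wnorm U) <= winner P U.
Proof.
have [/wnorm0_eq0 -> | Pn0] := eqVneq (wnorm P) 0.
  by rewrite -(scale0r 0) winnerZl wnormZ normr0 !mul0r oppr0.
have [/wnorm0_eq0 -> | Un0] := eqVneq (wnorm U) 0.
  by rewrite -(scale0r 0) winnerZr wnormZ normr0 !mul0r mulr0 oppr0.
have PU_gt0 : 0 < wnorm P * wnorm U.
  by rewrite mulr_gt0 // lt_def ?Pn0 ?Un0 wnorm_ge0.
(* This combination vanishes in the equality case U = - (|U| / |P|) P. *)
have := sqr_ge0 (wnorm (wnorm U *: P + wnorm P *: U)).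
rewrite wnorm_sqr !(winnerDl, winnerDr, winnerZl, winnerZr).
rewrite -!wnorm_sqr (winnerC U P) => sq_ge0.
rewrite -(ler_pM2l PU_gt0); lra.
Qed.

End WeightsInnerProduct.

(** The midpoint case of convexity of h - sigma/2 |.|^2, combined with the
    parallelogram identity.  It serves twice: with V = - U it bounds an even h
    from below by a quadratic, and at two minimizers it forces U = V. *)
Lemma strongly_convex_midpoint (R : realType) (N : nat) (dims : nat -> nat)
    (sigma : R) (h : weights R N dims -> R) (U V : weights R N dims) :
  strongly_convex sigma h ->
  h (2^-1 *: (U + V)) + sigma / 8 * wnorm (U - V) ^+ 2 <= 2^-1 * (h U + h V).
Proof.
move=> hconv.
have half_ge0 : 0 <= 2^-1 :> R by rewrite invr_ge0.
have half_le1 : 2^-1 <= 1 :> R by rewrite invf_le1 // ler1n.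
have := hconv (Itv01 half_ge0 half_le1) U V (mem_set I) (mem_set I).
rewrite /conv /= /conv /= /unstable.onem (_ : 1 - 2^-1 = 2^-1 :> R); last by field.
rewrite -scalerDr !wnorm_sqr.
rewrite !(winnerDl, winnerDr, winnerZl, winnerZr, winnerNl, winnerNr).
by rewrite (winnerC V U) /GRing.scale /=; lra.
Qed.

(** * Minimizing a tilted radial function *)

(** The convexity of a radial profile G with derivative a e, in the form of its
    tangent inequality: it is the only link between a kernel and its scalar
    equation, and no derivative has to be computed.  The factor a is split off
    because the profile of the kernel at radius r sqrt N has derivative N e,
    where e is the nondecreasing part of the scalar equation. *)
Definition slope_minorizes (R : realType) (a : R) (G e : R -> R) : Prop :=
  forall r s, 0 <= r -> 0 <= s -> G r + a * e r * (s - r) <= G s.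

Section RadialMinimization.
Variables (R : realType) (N : nat) (dims : nat -> nat).
Local Notation W := (weights R N dims).
Hypothesis N_gt0 : (0 < N)%N.
Variables (h : W -> R) (G e : R -> R) (sigma : R).
Hypothesis hG : forall U, h U = G (wnorm U / Num.sqrt N%:R).
Hypothesis Ge : slope_minorizes N%:R G e.
Hypothesis e0 : e 0 = 0.
Hypothesis e_cont : continuous e.
Hypothesis sigma_gt0 : 0 < sigma.
Hypothesis h_strong : strongly_convex sigma h.

Let sqrtN_gt0 : 0 < Num.sqrt N%:R :> R.
Proof. by rewrite sqrtr_gt0 ltr0n. Qed.

Let sqrtN_sqr : Num.sqrt N%:R ^+ 2 = N%:R :> R.
Proof. by rewrite sqr_sqrtr. Qed.

(** By strong convexity and evenness, G b >= G 0 + N sigma/2 b^2, while the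
    tangent at b, evaluated at 0, gives G b - G 0 <= N b e b.  The matrix P only
    witnesses that the space of weights is not zero: in the zero space h carries
    no information on G away from 0. *)
Lemma slope_growth (P : W) (b : R) :
  wnorm P != 0 -> 0 < b -> sigma / 2 * b <= e b.
Proof.
move=> P_neq0 b_gt0; pose V : W := (b * Num.sqrt N%:R / wnorm P) *: P.
have b_ge0 := ltW b_gt0.
have normV : wnorm V = b * Num.sqrt N%:R.
  rewrite wnormZ ger0_norm ?divfK // divr_ge0 ?wnorm_ge0 //.
  by rewrite mulr_ge0 ?ltW.
have := strongly_convex_midpoint V (- V) h_strong.
rewrite opprK (_ : V + V = 2 *: V); last by rewrite scaler_nat mulr2n.
rewrite subrr scaler0 wnormZ !hG wnormN normV.
rewrite mulfK ?gt_eqF // -(scale0r 0) wnormZ !normr0 mul0r mul0r.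
rewrite normr_nat !exprMn sqrtN_sqr => growth.
have tangent := Ge b_ge0 (lexx 0).
have N_pos : 0 < N%:R :> R by rewrite ltr0n.
rewrite -(ler_pM2l (mulr_gt0 N_pos b_gt0)); lra.
Qed.

(** The left-hand side is nonpositive at 0, and nonnegative where the linear lower
    bound on e reaches |P| / sqrt N. *)
Lemma slope_equation_solvable (P : W) :
  exists2 r, 0 <= r & e r - wnorm P / Num.sqrt N%:R = 0.
Proof.
have [-> | P_neq0] := eqVneq (wnorm P) 0.
  by exists 0 => //; rewrite e0 mul0r subr0.
set v := wnorm P / _.
have v_gt0 : 0 < v by rewrite divr_gt0 // lt_def P_neq0 wnorm_ge0.
pose b := 2 / sigma * v.
have b_gt0 : 0 < b by rewrite mulr_gt0 // divr_gt0.
have eb : v <= e b.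
  have <- : sigma / 2 * b = v by rewrite /b; field; rewrite gt_eqF.
  exact: slope_growth P_neq0 b_gt0.
have v_between : Num.min (e 0) (e b) <= v <= Num.max (e 0) (e b).
  by rewrite e0 ge_min le_max (ltW v_gt0) eb orbT.
have [r rab er] := IVT (ltW b_gt0) (continuous_subspaceT e_cont) v_between.
exists r; last by rewrite er subrr.
by move: rab; rewrite in_itv => /andP[].
Qed.

(** Add up the Cauchy-Schwarz inequality for P and V and the tangent inequality
    of G at r: the root condition makes the terms in |V| cancel. *)
Lemma update_minimizes (P : W) (r : R) (V : W) :
  0 <= r -> e r - wnorm P / Num.sqrt N%:R = 0 ->
  h (bpg_update P r) + winner P (bpg_update P r) <= h V + winner P V.
Proof.
move=> r_ge0 /subr0_eq er.
set t := wnorm V / Num.sqrt N%:R.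
have t_ge0 : 0 <= t by rewrite divr_ge0 ?wnorm_ge0 ?ltW.
have normV : wnorm V = t * Num.sqrt N%:R by rewrite divfK ?gt_eqF.
have := winner_ge P V; rewrite normV [h V]hG -/t.
(* For P = 0 the update is 0 by convention, whatever r is, and it minimizes h
   because the tangent of G at 0 is horizontal. *)
have [P_eq0 | P_neq0] := eqVneq (wnorm P) 0.
  have -> : bpg_update P r = 0 *: 0.
    apply: functional_extensionality_dep => i.
    by rewrite /bpg_update P_eq0 eqxx scale0r.
  rewrite hG winnerZr wnormZ normr0 P_eq0 !mul0r.
  have := Ge (lexx 0) t_ge0; rewrite e0; lra.
have -> : bpg_update P r = - (r * (Num.sqrt N%:R / wnorm P)) *: P.
  by apply: functional_extensionality_dep => i; rewrite /bpg_update (negbTE P_neq0).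
rewrite hG wnormZ winnerZr -wnorm_sqr normrN ger0_norm; last first.
  by rewrite mulr_ge0 // divr_ge0 ?wnorm_ge0 ?sqrtr_ge0.
have -> : r * (Num.sqrt N%:R / wnorm P) * wnorm P / Num.sqrt N%:R = r.
  by field; rewrite P_neq0 gt_eqF.
have -> : - (r * (Num.sqrt N%:R / wnorm P)) * wnorm P ^+ 2 =
    - (r * Num.sqrt N%:R * wnorm P).
  by field.
have := Ge r_ge0 t_ge0.
have -> : N%:R * e r = Num.sqrt N%:R * wnorm P.
  have sqrtN_neq0 : Num.sqrt N%:R != 0 :> R by rewrite gt_eqF.
  by apply: (mulIf sqrtN_neq0); rewrite er -mulrA divfK // mulrAC -expr2 sqrtN_sqr.
lra.
Qed.

Lemma linear_tilt_minimizer_unique (P U V : W) :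
  (forall T, h U + winner P U <= h T + winner P T) ->
  (forall T, h V + winner P V <= h T + winner P T) -> U = V.
Proof.
move=> minU minV; apply/eqP; rewrite -subr_eq0; apply/eqP/wnorm0_eq0.
have := strongly_convex_midpoint U V h_strong.
have := minU (2^-1 *: (U + V)); have := minV (2^-1 *: (U + V)).
rewrite winnerZr winnerDr => le1 le2 le3.
have : sigma / 8 * wnorm (U - V) ^+ 2 <= 0 by lra.
rewrite pmulr_rle0 ?divr_gt0 // => sq_le0.
by apply/eqP; rewrite -sqrf_eq0 eq_le sq_le0 sqr_ge0.
Qed.

Lemma minimizer_is_update (P U : W) :
  (forall V, h U + winner P U <= h V + winner P V) ->
  (exists2 r : R, 0 <= r & e r - wnorm P / Num.sqrt N%:R = 0) /\
  (forall r : R, 0 <= r -> e r - wnorm P / Num.sqrt N%:R = 0 ->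
     forall i : 'I_N, U i = bpg_update P r i).
Proof.
move=> minU; split=> [|r r_ge0 er i]; first exact: slope_equation_solvable.
by rewrite (linear_tilt_minimizer_unique minU
  (fun V => update_minimizes V r_ge0 er)).
Qed.

End RadialMinimization.

(** The tilt: lambda times the objective of the proximal step differs from
    h u + <P, u> by a constant in u. *)
Lemma bpg_map_minimizer (R : realType) (N : nat) (dims : nat -> nat)
    (g h : weights R N dims -> R) (lambda : R) (x u : weights R N dims) :
  0 < lambda -> bpg_map (fun=> 0) g h lambda x u ->
  let P := lambda *: wgrad g x - wgrad h x in
  forall v, h u + winner P u <= h v + winner P v.
Proof.
move=> lambda_gt0 min_u P v; have := min_u v; rewrite /bregman !add0r.
rewrite -(ler_pM2l lambda_gt0) !mulrDr !mulVKf ?gt_eqF //.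
rewrite /P !(winnerDl, winnerDr, winnerNl, winnerNr, winnerZl); lra.
Qed.

(** * The radial profiles of the kernels *)

(** Bernoulli's inequality, homogenized: in the inductive step the gap is
    (n + 1) r ^ n (s - r) ^ 2. *)
Lemma exprn_tangent (R : realType) (n : nat) (r s : R) :
  0 <= r -> 0 <= s -> r ^+ n.+1 + n.+1%:R * r ^+ n * (s - r) <= s ^+ n.+1.
Proof.
move=> r_ge0 s_ge0; elim: n => [|n IHn]; first by rewrite expr0 !expr1; lra.
rewrite (exprS s); apply: le_trans (ler_wpM2l s_ge0 IHn).
have sq_ge0 : 0 <= n.+1%:R * r ^+ n * (s - r) ^+ 2.
  by rewrite mulr_ge0 ?sqr_ge0 // mulr_ge0 ?exprn_ge0.
by rewrite -subr_ge0 !exprS -(natr1 n.+1); lra.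
Qed.

Lemma constants_ge0 (R : realType) (d d1 nT N : nat)
    (X : 'M[R]_(d, nT)) (Y : 'M[R]_(d1, nT)) : (2 <= N)%N ->
  [/\ 0 <= c1 X N, 0 <= c2 X Y N & 0 <= c3 X Y N].
Proof.
move=> N2; have N_ge2 : 2 <= N%:R :> R by rewrite ler_nat.
have frob_ge0 m n (A : 'M[R]_(m, n)) : 0 <= frob A by exact: sqrtr_ge0.
split.
- rewrite /c1 mulr_ge0 ?sqr_ge0 // divr_ge0 ?mulr_ge0 ?exprn_ge0 ?ler0n //; lra.
- rewrite /c2 divr_ge0 ?mulr_ge0 ?exprn_ge0 ?frob_ge0 //; lra.
- rewrite /c3 divr_ge0 ?mulr_ge0 ?exprn_ge0 ?frob_ge0 //; lra.
Qed.

Section SlopeMinorizes.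
Variables (R : realType) (a : R).
Implicit Types (G e : R -> R).

Lemma slope_minorizesD G1 G2 e1 e2 :
  slope_minorizes a G1 e1 -> slope_minorizes a G2 e2 ->
  slope_minorizes a (fun r => G1 r + G2 r) (fun r => e1 r + e2 r).
Proof.
move=> G1e G2e r s r_ge0 s_ge0.
have := G1e r s r_ge0 s_ge0; have := G2e r s r_ge0 s_ge0; lra.
Qed.

Lemma slope_minorizesZ c G e : 0 <= c ->
  slope_minorizes a G e ->
  slope_minorizes a (fun r => c * G r) (fun r => c * e r).
Proof.
move=> c_ge0 Ge r s r_ge0 s_ge0.
have := ler_wpM2l c_ge0 (Ge r s r_ge0 s_ge0); lra.
Qed.

End SlopeMinorizes.

Section KernelProfiles.
Variables (R : realType) (N : nat).
Hypothesis N_gt0 : (0 < N)%N.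

Let NR_gt0 : 0 < N%:R :> R.
Proof. by rewrite ltr0n. Qed.

Lemma H1_slope :
  slope_minorizes N%:R (fun r : R => r ^+ (2 * N)) (fun r => 2 * r ^+ (2 * N - 1)).
Proof.
move=> r s r_ge0 s_ge0; have := exprn_tangent (2 * N - 1) r_ge0 s_ge0.
rewrite subn1 prednK ?muln_gt0 // natrM; lra.
Qed.

Lemma H2_slope :
  slope_minorizes N%:R (fun r : R => r ^+ N) (fun r => r ^+ (N - 1)).
Proof.
move=> r s r_ge0 s_ge0; have := exprn_tangent (N - 1) r_ge0 s_ge0.
by rewrite subn1 prednK.
Qed.

(** Here the base of the power is q r, with q quadratic: compose the tangent
    inequality of the power m + 1 = (N + 1) / 2 at q r with that of q at r, whose
    slope 2 N r / (N + 1) is N r / (m + 1). *)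
Lemma H3_slope : odd N ->
  slope_minorizes N%:R
    (fun r : R => ((N%:R * r ^+ 2 + 1) / (N%:R + 1)) ^+ N.+1./2)
    (fun r => ((N%:R * r ^+ 2 + 1) / (N%:R + 1)) ^+ (N - 1)./2 * r).
Proof.
move=> N_odd r s r_ge0 s_ge0.
pose q (t : R) := (N%:R * t ^+ 2 + 1) / (N%:R + 1).
rewrite -[X in X ^+ N.+1./2 + _]/(q r) -[X in _ <= X ^+ _]/(q s).
rewrite -[X in X ^+ (N - 1)./2]/(q r).
have N1_gt0 : 0 < N%:R + 1 :> R by rewrite addr_gt0.
have q_ge0 t : 0 <= q t.
  by rewrite divr_ge0 ?(ltW N1_gt0) // addr_ge0 // mulr_ge0 ?sqr_ge0 ?ltW.
pose m := (N - 1)./2.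
have N1 : N.+1 = (m.+1).*2.
  rewrite /m -[N in LHS]odd_double_half -[N in RHS]odd_double_half N_odd.
  by rewrite addKn doubleK -doubleS.
have -> : N.+1./2 = m.+1 by rewrite N1 doubleK.
apply: le_trans (exprn_tangent m (q_ge0 r) (q_ge0 s)).
have N1R : N%:R + 1 = 2 * m.+1%:R :> R.
  by rewrite natr1 N1 -muln2 natrM mulrC.
have q_gap : N%:R * r * (s - r) <= m.+1%:R * (q s - q r).
  have -> : m.+1%:R * (q s - q r) = N%:R / 2 * (s ^+ 2 - r ^+ 2).
    have := pnatr_eq0 R m.+1; rewrite /q N1R; move: m.+1%:R => k k_eq0.
    by field; rewrite k_eq0.
  have := mulr_ge0 (ltW NR_gt0) (sqr_ge0 (s - r)); lra.
have := ler_wpM2l (exprn_ge0 m (q_ge0 r)) q_gap; rewrite -/m; lra.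
Qed.

Lemma H4_slope :
  slope_minorizes N%:R (fun r : R => r ^+ 2) (fun r => 2 / N%:R * r).
Proof.
move=> r s _ _; have := sqr_ge0 (s - r).
have -> : N%:R * (2 / N%:R * r) * (s - r) = 2 * r * (s - r).
  by field; rewrite gt_eqF.
lra.
Qed.

End KernelProfiles.

Lemma scaled_exp_continuous (R : realType) (c : R) (n : nat) :
  continuous (fun r : R => c * r ^+ n).
Proof.
by move=> x; apply: cvgM; [exact: cvg_cst | exact: exprn_continuous].
Qed.

(** * The update formula *)

Theorem proposition9 (R : realType) (N nT : nat) (dims : nat -> nat)
    (hN : (2 <= N)%N) (hnT : (0 < nT)%N)
    (hdims : forall i, (i <= N)%N -> (0 < dims i)%N)
    (X : 'M[R]_(dims N, nT)) (Y : 'M[R]_(dims 0, nT))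
    (rho sigma L lambda : R)
    (hrho_even : (2 < N)%N -> ~~ odd N -> 0 < rho)
    (hrho_odd : (2 < N)%N -> odd N -> 0 <= rho)
    (hsigma : 0 < sigma)
    (hstrong : strongly_convex sigma (kernel X Y rho))
    (hL : 0 < L)
    (hsub : wconvex (fun U => L * kernel X Y rho U - loss X Y U))
    (hadd : wconvex (fun U => L * kernel X Y rho U + loss X Y U))
    (hlambda0 : 0 < lambda) (hlambdaL : lambda < 1 / L)
    (W : nat -> weights R N dims)
    (hBPG : forall k, (1 <= k)%N ->
      bpg_map (fun=> 0) (loss X Y) (kernel X Y rho) lambda (W k) (W k.+1))
    (k : nat) (hk : (1 <= k)%N) :
  let P : weights R N dims := fun i =>
    lambda *: wgrad (loss X Y) (W k) i - wgrad (kernel X Y rho) (W k) i in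
  let normP := wnorm P in
  let update_given_by (E : R -> R) :=
    (exists2 r : R, 0 <= r & E r = 0) /\
    (forall r : R, 0 <= r -> E r = 0 ->
       forall i : 'I_N, W k.+1 i = bpg_update P r i) in
  [/\ N = 2 ->
        update_given_by (fun r =>
          2 * c1 X 2 * r ^+ 3 + c2 X Y 2 * r - normP / Num.sqrt 2),
      (2 < N)%N -> ~~ odd N ->
        update_given_by (fun r =>
          2 * c1 X N * r ^+ (2 * N - 1) + c2 X Y N * r ^+ (N - 1)
          + 2 * rho / N%:R * r - normP / Num.sqrt N%:R)
    & (2 < N)%N -> odd N ->
        update_given_by (fun r =>
          2 * c1 X N * r ^+ (2 * N - 1)
          + c3 X Y N * ((N%:R * r ^+ 2 + 1) / (N%:R + 1)) ^+ (N - 1)./2 * r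
          + 2 * rho / N%:R * r - normP / Num.sqrt N%:R)].

Proof.
move=> P normP update_given_by.
have N_gt0 : (0 < N)%N by exact: ltn_trans hN.
have [c1_ge0 c2_ge0 c3_ge0] := constants_ge0 X Y hN.
have W_min := bpg_map_minimizer hlambda0 (hBPG k hk).
have q_sqr (U : weights R N dims) :
    (wnorm U / Num.sqrt N%:R) ^+ 2 = wnorm U ^+ 2 / N%:R.
  by rewrite expr_div_n (sqr_sqrtr (ler0n R N)).
have q_exp_even (U : weights R N dims) : ~~ odd N ->
    (wnorm U / Num.sqrt N%:R) ^+ N = (wnorm U ^+ 2 / N%:R) ^+ N./2.
  by move=> N_even; rewrite -q_sqr -exprM mul2n even_halfK.
have exp0 n : (2 <= n)%N -> 0 ^+ (n - 1) = 0 :> R.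
  by case: n => [|[|n]] // _; rewrite subn1 expr0n.
have N2_ge2 : (2 <= 2 * N)%N by rewrite leq_pmulr.
split.
- move=> N2; change (N = 2%N) in N2; subst N.
  apply: (minimizer_is_update
    (G := fun r => c1 X 2 * r ^+ (2 * 2) + c2 X Y 2 * r ^+ 2)
    (e := fun r => 2 * c1 X 2 * r ^+ 3 + c2 X Y 2 * r)
    N_gt0 _ _ _ _ hsigma hstrong W_min).
  + by move=> U; rewrite /kernel /= /H1 /H2 q_exp_even // exprM q_sqr.
  + move=> r s r_ge0 s_ge0.
    have := slope_minorizesD (slope_minorizesZ c1_ge0 (H1_slope N_gt0))
      (slope_minorizesZ c2_ge0 (H2_slope N_gt0)) r_ge0 s_ge0.
    by rewrite /= expr1; lra.
  + by rewrite expr0n /= !mulr0 addr0.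
  + move=> x; apply: cvgD; first exact: scaled_exp_continuous.
    exact: (@scaled_exp_continuous _ _ 1).
- move=> N_gt2 N_even; have rho_ge0 := ltW (hrho_even N_gt2 N_even).
  apply: (minimizer_is_update
    (G := fun r => c1 X N * r ^+ (2 * N) + c2 X Y N * r ^+ N + rho * r ^+ 2)
    (e := fun r => 2 * c1 X N * r ^+ (2 * N - 1) + c2 X Y N * r ^+ (N - 1)
          + 2 * rho / N%:R * r)
    N_gt0 _ _ _ _ hsigma hstrong W_min).
  + move=> U; rewrite /kernel gtn_eqF // (negbTE N_even) /H1 /H2 /H4.
    by rewrite q_exp_even // exprM q_sqr.
  + move=> r s r_ge0 s_ge0.
    have := slope_minorizesD (slope_minorizesD
      (slope_minorizesZ c1_ge0 (H1_slope N_gt0))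
      (slope_minorizesZ c2_ge0 (H2_slope N_gt0)))
      (slope_minorizesZ rho_ge0 (H4_slope N_gt0)) r_ge0 s_ge0.
    lra.
  + by rewrite (exp0 _ hN) (exp0 _ N2_ge2) !mulr0 !addr0.
  + move=> x; apply: cvgD; last exact: (@scaled_exp_continuous _ _ 1).
    by apply: cvgD; exact: scaled_exp_continuous.
- move=> N_gt2 N_odd; have rho_ge0 := hrho_odd N_gt2 N_odd.
  apply: (minimizer_is_update
    (G := fun r => c1 X N * r ^+ (2 * N)
      + c3 X Y N * ((N%:R * r ^+ 2 + 1) / (N%:R + 1)) ^+ N.+1./2 + rho * r ^+ 2)
    (e := fun r => 2 * c1 X N * r ^+ (2 * N - 1)
          + c3 X Y N * ((N%:R * r ^+ 2 + 1) / (N%:R + 1)) ^+ (N - 1)./2 * r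
          + 2 * rho / N%:R * r)
    N_gt0 _ _ _ _ hsigma hstrong W_min).
  (* N q^2 = |U|^2 turns the base of H3 into the base of its profile. *)
  + move=> U; rewrite /kernel gtn_eqF // N_odd /H1 /H3 /H4 exprM q_sqr.
    by rewrite (mulrC N%:R) divfK // pnatr_eq0 -lt0n.
  + move=> r s r_ge0 s_ge0.
    have := slope_minorizesD (slope_minorizesD
      (slope_minorizesZ c1_ge0 (H1_slope N_gt0))
      (slope_minorizesZ c3_ge0 (H3_slope N_gt0 N_odd)))
      (slope_minorizesZ rho_ge0 (H4_slope N_gt0)) r_ge0 s_ge0.
    lra.
  + by rewrite (exp0 _ N2_ge2) !mulr0 !addr0.
  + move=> x; apply: cvgD; last exact: (@scaled_exp_continuous _ _ 1).
    apply: cvgD; first exact: scaled_exp_continuous.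
    apply: cvgM; last exact: cvg_id.
    apply: cvgM; first exact: cvg_cst.
    apply: (@continuous_comp _ _ _
      (fun r : R => (N%:R * r ^+ 2 + 1) / (N%:R + 1)) (fun t => t ^+ (N - 1)./2)).
      apply: cvgM; last exact: cvg_cst.
      by apply: cvgD; [exact: scaled_exp_continuous | exact: cvg_cst].
    exact: exprn_continuous.
Qed.
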